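(* There exist an absolute constant $\epsilon_0>0$ and a function $\eta:(0,\epsilon_0]\to[0,\infty)$ with $\eta(\epsilon)\to0$ as $\epsilon\to0$ such that for every $0<\epsilon\le\epsilon_0$ there exist a finite set $P_\epsilon\subset\mathbb{R}^3$ and a point $s\in P_\epsilon$ such that every $(1+\epsilon,\beta)$-shallow-light tree for $P_\epsilon$ rooted at $s$ (with respect to the Euclidean metric) has $\beta\ge(1-\eta(\epsilon))\frac1\epsilon$.
   Context: For a finite point set $P\subset\mathbb{R}^d$, consider the complete graph on $P$ in which each edge $xy$ has weight $w(x,y)=\|x-y\|_2$. For a graph $H$ on $P$, $w(H)$ is the sum of its edge weights, and $\mathrm{dist}_H$ is the weighted shortest-path distance in $H$. Let $\mathrm{MST}(P)$ be a minimum-weight spanning tree of this complete graph. For $\alpha,\beta\ge 1$ and $s\in P$, an $(\alpha,\beta)$-shallow-light tree (SLT) for $P$ rooted at $s$ is a spanning tree $T$ of the complete graph on $P$ (no Steiner points) such that $\mathrm{dist}_T(s,t)\le\alpha\cdot w(s,t)$ for all $t\in P$, and $w(T)\le\beta\cdot w(\mathrm{MST}(P))$. *)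

(* Defs.v *)
From HB Require Import structures.
From mathcomp Require Import all_boot all_order all_algebra finmap.
From mathcomp Require Import all_classical all_reals all_analysis.
Set Implicit Arguments.
Unset Strict Implicit.
Unset Printing Implicit Defensive.
Import Order.TTheory GRing.Theory Num.Theory.
Import numFieldNormedType.Exports.
Local Open Scope classical_set_scope.
Local Open Scope ring_scope.

(* The canonical norm on 'rV[R]_d is the sup norm, hence this definition. *)
Definition euclid_dist (R : realType) (d : nat) (x y : 'rV[R]_d) : R :=
  Num.sqrt (\sum_(i < d) (x ord0 i - y ord0 i) ^+ 2).

Section WeightedGraphs.
Variables (R : realType) (V : finType) (w : V -> V -> R).
Implicit Types (e : rel V) (s t : V) (p : seq V).

Definition simple_graph e : Prop := symmetric e /\ irreflexive e.

Definition connected_graph e : Prop := forall u v : V, connect e u v.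

(* For a symmetric e, [:: u; v] is an e-cycle as soon as uv is an edge, so only
   cycles on at least three vertices are excluded. *)
Definition acyclic_graph e : Prop :=
  forall c : seq V, ucycle e c -> (size c <= 2)%N.

Definition spanning_tree e : Prop :=
  [/\ simple_graph e, connected_graph e & acyclic_graph e].

(* The sum over ordered pairs counts every edge twice. *)
Definition graph_weight e : R := (\sum_u \sum_(v | e u v) w u v) / 2.

(* The walk s :: p. *)
Fixpoint walk_weight s p : R :=
  if p is t :: p' then w s t + walk_weight t p' else 0.

(* Equal to +oo when t is not reachable from s. *)
Definition graph_dist e s t : \bar R :=
  ereal_inf [set (walk_weight s p)%:E | p in [set p | path e s p /\ last s p = t]].

Definition is_mst e : Prop :=
  spanning_tree e /\
  forall e' : rel V, spanning_tree e' -> graph_weight e <= graph_weight e'.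

Definition is_slt (alpha beta : R) s e : Prop :=
  [/\ 1 <= alpha, 1 <= beta, spanning_tree e,
      forall t, (graph_dist e s t <= (alpha * w s t)%:E)%E &
      forall m : rel V, is_mst m -> graph_weight e <= beta * graph_weight m].

End WeightedGraphs.

Definition point_weight (R : realType) (d : nat) (P : {fset 'rV[R]_d})
    (x y : P) : R :=
  euclid_dist (val x) (val y).

(* Main.v *)
(* Put the root s at height 1 above a corner of a planar square grid of side about
   a = eps^(1/4) and spacing delta = eps (1 + 8 a). The distance to s varies slowly
   over the grid, so reaching a grid point t through another grid point costs at least
   |st| + delta (1 - 2 a) > (1 + eps) |st|. Hence a tree of root stretch 1 + eps joins
   s directly to each of the N grid points and weighs at least N, while a comb along
   the grid lines shows that the MST weighs at most N delta + 1. Since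
   N >= (a / delta)^2, the ratio is at least 1 / (delta (1 + delta / a^2))
   >= (1 - 9 a) / eps. *)
Require Import Defs.
From HB Require Import structures.
From mathcomp Require Import all_boot all_order all_algebra finmap.
From mathcomp Require Import all_classical all_reals all_analysis.
From mathcomp Require Import ring lra.
Set Implicit Arguments.
Unset Strict Implicit.
Unset Printing Implicit Defensive.
Import Order.TTheory GRing.Theory Num.Theory.
Import numFieldNormedType.Exports.
Local Open Scope classical_set_scope.
Local Open Scope ring_scope.

(** * The Euclidean distance as a metric *)

(** Cauchy-Schwarz by Lagrange's identity: the double sum of squares is twice the defect. *)
Lemma sum_mul_sqr_le (R : realType) (d : nat) (a b : 'I_d -> R) :
  (\sum_i a i * b i) ^+ 2 <= (\sum_i a i ^+ 2) * (\sum_i b i ^+ 2).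
Proof.
have : 0 <= \sum_i \sum_j (a i * b j - a j * b i) ^+ 2.
  by do 2![apply: sumr_ge0 => ? _]; exact: sqr_ge0.
have -> : \sum_i \sum_j (a i * b j - a j * b i) ^+ 2 =
    2 * ((\sum_i a i ^+ 2) * (\sum_i b i ^+ 2) - (\sum_i a i * b i) ^+ 2).
  rewrite mulrBr [(\sum_i a i * b i) ^+ 2]expr2 !big_distrlr /= mulr_natl mulr2n.
  rewrite [X in _ = _ + X - _]exchange_big /= mulr_sumr -big_split -sumrB /=.
  apply: eq_bigr => i _.
  rewrite mulr_sumr -big_split -sumrB /=; apply: eq_bigr => j _; ring.
by rewrite pmulr_rge0 // subr_ge0.
Qed.

Lemma euclid_dist_ge0 (R : realType) (d : nat) (x y : 'rV[R]_d) :
  0 <= euclid_dist x y.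
Proof. exact: sqrtr_ge0. Qed.

Lemma euclid_distxx (R : realType) (d : nat) (x : 'rV[R]_d) :
  euclid_dist x x = 0.
Proof.
by rewrite /euclid_dist big1 ?sqrtr0 // => i _; rewrite subrr expr0n.
Qed.

Lemma euclid_distC (R : realType) (d : nat) (x y : 'rV[R]_d) :
  euclid_dist x y = euclid_dist y x.
Proof. by congr Num.sqrt; apply: eq_bigr => i _; rewrite -opprB sqrrN. Qed.

Lemma euclid_dist_triangle (R : realType) (d : nat) (y x z : 'rV[R]_d) :
  euclid_dist x z <= euclid_dist x y + euclid_dist y z.
Proof.
have sq_dist u v : euclid_dist u v ^+ 2 = \sum_i (u ord0 i - v ord0 i) ^+ 2 :> R.
  by rewrite sqr_sqrtr // sumr_ge0 // => i _; exact: sqr_ge0.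
rewrite -ler_sqr ?nnegrE ?addr_ge0 ?euclid_dist_ge0 //.
pose a i := x ord0 i - y ord0 i; pose b i := y ord0 i - z ord0 i.
have -> : euclid_dist x z ^+ 2 = euclid_dist x y ^+ 2 + euclid_dist y z ^+ 2 +
    (\sum_i a i * b i) *+ 2.
  rewrite !sq_dist -sumrMnl -!big_split /=; apply: eq_bigr => i _.
  by rewrite /a /b; ring.
have CS : \sum_i a i * b i <= euclid_dist x y * euclid_dist y z.
  apply: le_trans (ler_norm _) _.
  rewrite -ler_sqr ?nnegrE ?normr_ge0 ?mulr_ge0 ?euclid_dist_ge0 //.
  by rewrite real_normK ?num_real // exprMn !sq_dist sum_mul_sqr_le.
by rewrite sqrrD addrAC lerD2r lerD2l lerMn2r CS orbT.
Qed.

(** * Spanning trees and forced edges in finite weighted graphs *)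

Section Graphs.
Variables (R : realType) (V : finType) (w : V -> V -> R).

(** [is_slt] bounds the weight against every minimum spanning tree, which says something only once
    one exists. Coding relations as finite functions on pairs makes the minimisation finite. *)
Lemma exists_mst (e0 : rel V) : spanning_tree e0 -> exists m, is_mst w m.
Proof.
pose gr (f : {ffun V * V -> bool}) : rel V := fun u v => f (u, v).
have grK (e : rel V) : gr [ffun p => e p.1 p.2] = e.
  by apply/funext => u; apply/funext => v; rewrite /gr ffunE.
move=> tree0; pose f0 : {ffun V * V -> bool} := [ffun p => e0 p.1 p.2].
pose Q f := `[< spanning_tree (gr f) >].
have Qf0 : Q f0 by apply/asboolP; rewrite grK.
case: (@arg_minP _ _ _ f0 Q (fun f => graph_weight w (gr f)) Qf0).
move=> f /asboolP treef minf.
exists (gr f); split=> // e tree_e.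
by rewrite -(grK e); apply: minf; apply/asboolP; rewrite grK.
Qed.

Section ParentTree.
Variables (root : V) (parent : V -> V) (rank : V -> nat).
Hypothesis parent_rank : forall v, v != root -> (rank (parent v) < rank v)%N.

Definition parent_rel : rel V := fun u v =>
  (u != root) && (parent u == v) || (v != root) && (parent v == u).

Lemma parent_rel_sym : symmetric parent_rel.
Proof. by move=> u v; rewrite /parent_rel orbC. Qed.

Lemma parent_rel_rank u v :
  parent_rel u v -> (rank v <= rank u)%N -> v = parent u.
Proof.
case/orP=> /andP[nr /eqP pE]; first by rewrite pE.
by move: (parent_rank nr); rewrite pE ltnNge => /negP.
Qed.

Lemma spanning_tree_parent_rel : spanning_tree parent_rel.
Proof.
split.
- split; first exact: parent_rel_sym.
  move=> u; apply/negbTE/negP; rewrite /parent_rel orbb => /andP[/parent_rank].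
  by move=> lt /eqP pE; move: lt; rewrite pE ltnn.
- have to_root v : connect parent_rel v root.
    have [n] := ubnP (rank v); elim: n v => // n IHn v lev.
    have [-> // | nr] := eqVneq v root.
    apply: (@connect_trans _ _ (parent v)).
      by apply: connect1; rewrite /parent_rel nr eqxx.
    by apply: IHn; apply: leq_trans (parent_rank nr) _.
  move=> u v; apply: connect_trans (to_root u) _.
  by rewrite (sym_connect_sym parent_rel_sym) to_root.
- move=> c /andP[cyc uc]; rewrite leqNgt; apply/negP => lt2.
  (* The two neighbours on the cycle of a vertex of maximal rank are both its parent. *)
  have [x0 x0c] : exists x0, x0 \in c.
    by case: c lt2 {cyc uc} => // x c' _; exists x; rewrite mem_head.
  case: (@arg_maxnP _ x0 (mem c) rank x0c) => x xc maxx.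
  have [i c' rotE] := rot_to xc.
  have memc y : (y \in x :: c') = (y \in c) by rewrite -rotE mem_rot.
  (* Rotated to start at [x], the cycle reads [x], [y], ..., [z]; having at least three vertices, it
     lists [y] and [z] separately, so [y = z] contradicts uniqueness. *)
  move: cyc uc lt2; rewrite -(rot_cycle i) -(rot_uniq i) -(size_rot i) rotE.
  case: c' rotE memc => // y c' _; case/lastP: c' => // c' z memc.
  rewrite /= rcons_path last_rcons => /and3P[exy _ ezx] /and3P[_ yc' _] _.
  have yE : y = parent x.
    by apply: parent_rel_rank exy (maxx _ _); rewrite /= -memc !inE eqxx orbT.
  have zE : z = parent x.
    apply: parent_rel_rank (maxx _ _); first by rewrite parent_rel_sym.
    by rewrite /= -memc !inE mem_rcons mem_head !orbT.
  by move: yc'; rewrite yE zE mem_rcons mem_head.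
Qed.

(** The indicator of an edge is at most the sum of the indicators of its two parent orientations.
    One copy of the parent sum pays for each orientation, the second copy after transposition. *)
Lemma graph_weight_parent_rel_le :
  (forall u v, 0 <= w u v) -> (forall u v, w u v = w v u) ->
  graph_weight w parent_rel <= \sum_(v | v != root) w v (parent v).
Proof.
move=> w0 wC; rewrite /graph_weight ler_pdivrMr // mulr_natr mulr2n.
have sumE : \sum_(v | v != root) w v (parent v) =
    \sum_u \sum_v (if (u != root) && (parent u == v) then w u v else 0).
  rewrite [LHS]big_mkcond; apply: eq_bigr => u _.
  rewrite -big_mkcond /=; case: ifP => _ /=; last by rewrite big_pred0.
  by rewrite (big_pred1 (parent u)) // => v; rewrite eq_sym.
rewrite {1}sumE {}sumE [X in _ <= _ + X]exchange_big -big_split.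
apply: ler_sum => u _; rewrite -big_split big_mkcond; apply: ler_sum => v _ /=.
rewrite /parent_rel (wC v u).
by do 2![case: (_ && _)]; rewrite /= ?addr0 ?add0r ?lerDl.
Qed.

End ParentTree.

Lemma walk_weight_rcons s p t :
  walk_weight w s (rcons p t) = walk_weight w s p + w (last s p) t.
Proof. by elim: p s => [|x p IHp] s /=; rewrite ?addr0 ?add0r // IHp addrA. Qed.

Lemma walk_weight_ge :
  (forall u, w u u = 0) -> (forall u v x, w u x <= w u v + w v x) ->
  forall s p, w s (last s p) <= walk_weight w s p.
Proof.
move=> wxx tri s p; elim: p s => [|x p IHp] s /=; first by rewrite wxx.
by apply: le_trans (tri _ x _) _; rewrite lerD2l IHp.
Qed.

(* A strict inequality would not survive the infimum over all walks, hence the gap [g]. *)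
Lemma edge_of_detour (e : rel V) (s t : V) (x g : R) :
  (forall u, w u u = 0) -> (forall u v x, w u x <= w u v + w v x) ->
  irreflexive e -> t != s -> 0 < g ->
  (forall u, u != s -> u != t -> x + g <= w s u + w u t) ->
  (graph_dist w e s t <= x%:E)%E -> e s t.
Proof.
move=> wxx tri irr ts g0 detour; apply: contraLR => nst; rewrite -ltNge.
apply: (@lt_le_trans _ _ (x + g)%:E); first by rewrite lte_fin ltrDl.
apply: le_ereal_inf_tmp => _ [p [pp lastp] <-]; rewrite lee_fin.
(* Split off the last edge, from [u] to [t]. Here [u] differs from [s] because [s] and [t] are not
   adjacent, and from [t] by irreflexivity, so [detour] applies to it. *)
case/lastP: p pp lastp => [_ /= st | p z]; first by rewrite st eqxx in ts.
rewrite rcons_path last_rcons => /andP[_ ez] zt; subst z.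
rewrite walk_weight_rcons; set u := last s p in ez *.
have us : u != s by apply: contraNneq nst => <-.
have ut : u != t by apply: contraTneq ez => ->; rewrite irr.
by apply: le_trans (detour u us ut) _; rewrite lerD2r walk_weight_ge.
Qed.

(** Each spoke is met twice among ordered pairs: once in the row of [s], once in the entry at [s] of
    another row. *)
Lemma graph_weight_star_ge (e : rel V) (s : V) :
  (forall u v, 0 <= w u v) -> (forall u v, w u v = w v u) -> symmetric e ->
  (forall t, t != s -> e s t) ->
  \sum_(t | t != s) w s t <= graph_weight w e.
Proof.
move=> w0 wC sym star; rewrite /graph_weight ler_pdivlMr // mulr_natr mulr2n.
rewrite [leRHS](bigD1 s) //=; apply: lerD.
  rewrite big_mkcond [leRHS]big_mkcond; apply: ler_sum => t _.
  by case: ifPn => [/star -> // | _]; case: ifP.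
apply: ler_sum => u us; rewrite (bigD1 s) ?(sym u) ?star //= wC lerDl.
exact: sumr_ge0.
Qed.

End Graphs.

(** Lets the combinatorics run on an index type while the points form a finite subset of the
    space. *)
Lemma fset_of_injective (V : finType) (K : choiceType) (g : V -> K) :
  injective g -> exists (P : {fset K}) (h : V -> P),
    bijective h /\ forall v, val (h v) = g v.
Proof.
move=> g_inj; pose P : {fset K} := seq_fset tt (codom g).
have gP v : g v \in P by rewrite seq_fsetE codom_f.
pose h v : P := FSetSub (gP v); exists P, h; split=> //.
have h_inj : injective h by move=> u v /(congr1 val) /g_inj.
apply: inj_card_bij h_inj _.
rewrite -cardfE size_seq_fset (undup_id _) ?size_codom //.
by rewrite /codom map_inj_uniq ?enum_uniq.
Qed.

(** * Geometry of the grid and its apex *)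

Section Grid.
Variables (R : realType) (k : nat) (delta : R).

Definition point3 (x y z : R) : 'rV[R]_3 := \row_i [:: x; y; z]`_i.

Lemma euclid_dist_point3 x y z x' y' z' :
  euclid_dist (point3 x y z) (point3 x' y' z') =
  Num.sqrt ((x - x') ^+ 2 + (y - y') ^+ 2 + (z - z') ^+ 2).
Proof. by rewrite /euclid_dist !big_ord_recl big_ord0 !mxE /= addr0 addrA. Qed.

Definition grid_pos (v : option ('I_k.+1 * 'I_k.+1)) : 'rV[R]_3 :=
  if v is Some (i, j) then point3 (delta * i%:R) (delta * j%:R) 0
  else point3 0 0 1.

(** The comb: teeth run along [j], the spine is [j = 0], and the corner hangs from the root
    [None]. *)
Definition grid_parent (v : option ('I_k.+1 * 'I_k.+1)) :=
  if v is Some (i, j) then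
    if (0 < j)%N then Some (i, inord j.-1)
    else if (0 < i)%N then Some (inord i.-1, j) else None
  else None.

(** The depth in the comb. *)
Definition grid_rank (v : option ('I_k.+1 * 'I_k.+1)) : nat :=
  if v is Some (i, j) then (i + j).+1 else 0.

Lemma grid_parent_rank v :
  v != None -> (grid_rank (grid_parent v) < grid_rank v)%N.
Proof.
case: v => // -[i j] _ /=; case: ifP => [j0 | _]; last case: ifP => [i0 | _ //].
  have jk : (j.-1 < k.+1)%N by apply: leq_ltn_trans (leq_pred j) (ltn_ord j).
  by rewrite /= inordK // ltnS -addnS prednK.
have ik : (i.-1 < k.+1)%N by apply: leq_ltn_trans (leq_pred i) (ltn_ord i).
by rewrite /= inordK // ltnS -addSn prednK.
Qed.

Hypothesis delta_gt0 : 0 < delta.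

(** Only the edge from the corner to the root is long, of length 1. Granting it an extra [delta]
    keeps the bound uniform, so it sums to [delta] per grid point plus 1. *)
Lemma grid_dist_parent v : v != None ->
  euclid_dist (grid_pos v) (grid_pos (grid_parent v)) <=
  delta + (v == Some (ord0, ord0))%:R.
Proof.
case: v => // -[i j] _ /=.
have step (m : nat) (M : 'I_k.+1) : m = M -> (0 < m)%N ->
    delta * m%:R - delta * (inord m.-1 : 'I_k.+1)%:R = delta.
  move=> -> M0.
  have Mk : (M.-1 < k.+1)%N by apply: leq_ltn_trans (leq_pred M) (ltn_ord M).
  by rewrite inordK // -mulrBr -[in M%:R](prednK M0) -natr1 addrAC subrr add0r mulr1.
case: ifP => [j0 | /negbT j0]; last case: ifP => [i0 | /negbT i0].
- rewrite /= euclid_dist_point3 (step _ j) // !subrr !expr0n /= add0r addr0.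
  by rewrite sqrtr_sqr gtr0_norm // lerDl.
- rewrite /= euclid_dist_point3 (step _ i) // !subrr !expr0n /= !addr0.
  by rewrite sqrtr_sqr gtr0_norm // lerDl.
- move: i0 j0; rewrite -!eqn0Ngt => /eqP i0 /eqP j0.
  have -> : Some (i, j) == Some (ord0, ord0).
    by apply/eqP; congr (Some (_, _)); apply: val_inj.
  rewrite euclid_dist_point3 i0 j0 mulr0 subrr expr0n /= !add0r sqrrN expr1n sqrtr1.
  by rewrite lerDr ltW.
Qed.

Lemma grid_dist_ge i j i' j' : (i, j) != (i', j') ->
  delta <= euclid_dist (grid_pos (Some (i, j))) (grid_pos (Some (i', j'))).
Proof.
have sep (m n : nat) : m != n -> delta ^+ 2 <= (delta * m%:R - delta * n%:R) ^+ 2.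
  move=> mn; rewrite -mulrBr exprMn ler_peMr ?sqr_ge0 //.
  case: (ltngtP m n) mn => // lt _; move: lt; rewrite -(ler_nat R) -natr1 => lt; nra.
move=> neq; rewrite /= euclid_dist_point3 subrr expr0n /= addr0.
rewrite -[leLHS]gtr0_norm // -sqrtr_sqr ler_sqrt; last first.
  by rewrite addr_ge0 ?sqr_ge0.
move: neq; rewrite xpair_eqE negb_and => /orP[] /sep le.
  by apply: le_trans le _; rewrite lerDl sqr_ge0.
by apply: le_trans le _; rewrite lerDr sqr_ge0.
Qed.

Lemma grid_dist_root_ge1 v : v != None ->
  1 <= euclid_dist (grid_pos None) (grid_pos v).
Proof.
case: v => // -[i j] _; rewrite /= euclid_dist_point3 -[leLHS]sqrtr1 ler_sqrt.
  by rewrite subr0 expr1n lerDr addr_ge0 ?sqr_ge0.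
by rewrite !addr_ge0 ?sqr_ge0.
Qed.

Lemma grid_pos_inj : injective grid_pos.
Proof.
have root v : v != None -> grid_pos None <> grid_pos v.
  move=> /grid_dist_root_ge1 d1 E; move: d1.
  by rewrite -E euclid_distxx ler10.
move=> [[i j]|] [[i' j']|] E //.
- congr Some; apply/eqP/negPn/negP => /grid_dist_ge.
  by rewrite E euclid_distxx leNgt delta_gt0.
- by case: (root (Some (i, j))).
- by case: (root (Some (i', j'))).
Qed.

Lemma grid_coord (a : R) (i : 'I_k.+1) :
  delta * k%:R <= a -> 0 <= delta * i%:R <= a.
Proof.
move=> delta_le; rewrite mulr_ge0 ?(ltW delta_gt0) //=; apply: le_trans _ delta_le.
by rewrite ler_pM2l // ler_nat -ltnS ltn_ord.
Qed.

(** After squaring, [1 + 2 * a ^+ 2 <= (1 + a) ^+ 2], which follows from [a ^+ 2 <= a]. *)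
Lemma grid_dist_root_le a v :
  0 <= a <= 1 / 2 -> delta * k%:R <= a -> v != None ->
  euclid_dist (grid_pos None) (grid_pos v) <= 1 + a.
Proof.
move=> /andP[a_ge0 a_le] delta_le.
case: v => // -[i j] _; rewrite /= euclid_dist_point3.
move: (grid_coord i delta_le) (grid_coord j delta_le); set x := delta * _; set y := delta * _.
move=> /andP[x0 xa] /andP[y0 ya].
rewrite -[leRHS]ger0_norm ?addr_ge0 // -sqrtr_sqr ler_sqrt ?sqr_ge0 //.
have : x ^+ 2 <= a ^+ 2 by rewrite ler_sqr.
have : y ^+ 2 <= a ^+ 2 by rewrite ler_sqr.
have : a ^+ 2 <= a by rewrite expr2 ler_piMl //; lra.
lra.
Qed.

(* Over the patch the distance to the root is [2a]-Lipschitz, since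
   [A^2 - B^2 = (x - x')(x + x') + (y - y')(y + y')] and [A + B >= 2]. *)
Lemma grid_detour a u v :
  0 <= a <= 1 / 2 -> delta * k%:R <= a -> u != None -> v != None -> u != v ->
  euclid_dist (grid_pos None) (grid_pos v) + delta * (1 - 2 * a) <=
  euclid_dist (grid_pos None) (grid_pos u) + euclid_dist (grid_pos u) (grid_pos v).
Proof.
move=> /andP[a_ge0 a_le] delta_le; case: u v => [[i' j']|//] [[i j]|//] _ _ neq.
have D_ge := grid_dist_ge neq.
have A_ge1 := grid_dist_root_ge1 (isT : Some (i, j) != None).
have B_ge1 := grid_dist_root_ge1 (isT : Some (i', j') != None).
move: D_ge A_ge1 B_ge1; rewrite /= !euclid_dist_point3.
move: (grid_coord i delta_le) (grid_coord j delta_le).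
move: (grid_coord i' delta_le) (grid_coord j' delta_le).
set x := delta * i%:R; set y := delta * j%:R.
set x' := delta * i'%:R; set y' := delta * j'%:R.
move=> /andP[x'0 x'a] /andP[y'0 y'a] /andP[x0 xa] /andP[y0 ya].
rewrite !sub0r !subr0 !sqrrN expr1n expr0n /= addr0.
set A := Num.sqrt (x ^+ 2 + _ + _); set B := Num.sqrt (x' ^+ 2 + _ + _).
set D := Num.sqrt _ => D_ge A1 B1.
have A2 : A ^+ 2 = x ^+ 2 + y ^+ 2 + 1 by rewrite sqr_sqrtr // !addr_ge0 ?sqr_ge0.
have B2 : B ^+ 2 = x' ^+ 2 + y' ^+ 2 + 1 by rewrite sqr_sqrtr // !addr_ge0 ?sqr_ge0.
have Dx : `|x' - x| <= D by rewrite -sqrtr_sqr ler_sqrt ?lerDl ?addr_ge0 ?sqr_ge0.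
have Dy : `|y' - y| <= D by rewrite -sqrtr_sqr ler_sqrt ?lerDr ?addr_ge0 ?sqr_ge0.
have D0 : 0 <= D by exact: sqrtr_ge0.
move: Dx Dy; rewrite !ler_norml => /andP[Dx _] /andP[Dy _].
have hx : (x - x') * (x + x') <= D * (2 * a).
  apply: (@le_trans _ _ (D * (x + x'))); first by rewrite ler_wpM2r //; lra.
  by rewrite ler_wpM2l //; lra.
have hy : (y - y') * (y + y') <= D * (2 * a).
  apply: (@le_trans _ _ (D * (y + y'))); first by rewrite ler_wpM2r //; lra.
  by rewrite ler_wpM2l //; lra.
have AB : A - B <= 2 * a * D.
  (* In the opposite case [A - B] is nonnegative, so multiplying it by [A + B >= 2] gives
     [2 * (A - B) <= 4 * a * D], a contradiction. *)
  have [//|lt] := lerP (A - B) (2 * a * D).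
  have AB0 : 0 <= A - B by apply: le_trans (ltW lt); rewrite !mulr_ge0.
  have : (A - B) * 2 <= (A - B) * (A + B) by rewrite ler_wpM2l //; lra.
  have -> : (A - B) * (A + B) = (x - x') * (x + x') + (y - y') * (y + y').
    transitivity (A ^+ 2 - B ^+ 2); first by ring.
    by rewrite A2 B2; ring.
  lra.
have : delta * (1 - 2 * a) <= D * (1 - 2 * a) by rewrite ler_wpM2r //; lra.
lra.
Qed.

End Grid.

(** * From the grid to the bound on the lightness *)

(* [n] counts the grid points per side, and [n ^+ 2 * delta + 1] is the weight of a
   comb-shaped spanning tree, which dominates that of the MST. *)
Lemma ratio_bound (R : realType) (a n beta : R) (eps := a ^+ 4)
    (delta := eps * (1 + 8 * a)) :
  0 < a <= 1 / 8 -> a <= n * delta ->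
  n ^+ 2 <= beta * (n ^+ 2 * delta + 1) -> (1 - 9 * a) * (1 / eps) <= beta.
Proof.
move=> /andP[a0 a8] an ratio.
have eps0 : 0 < eps by rewrite exprn_gt0.
have delta0 : 0 < delta by rewrite mulr_gt0 //; lra.
have n0 : 0 < n by rewrite -(pmulr_lgt0 _ delta0); exact: lt_le_trans an.
have n2 : 0 < n ^+ 2 by rewrite exprn_gt0.
have beta0 : 0 < beta.
  rewrite -(pmulr_lgt0 _ (_ : 0 < n ^+ 2 * delta + 1)); first exact: lt_le_trans ratio.
  by rewrite addr_gt0 // mulr_gt0.
(* The additive 1 is absorbed: [a <= n * delta] and [delta <= 2 * eps], the latter from
   [a <= 1 / 8], give [1 <= n ^+ 2 * delta * (2 * a ^+ 2)]. *)
have mst_le : n ^+ 2 * delta + 1 <= n ^+ 2 * (delta * (1 + 2 * a ^+ 2)).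
  have : a ^+ 2 * 1 <= a ^+ 2 * (n ^+ 2 * delta * (2 * a ^+ 2)).
    have -> : a ^+ 2 * (n ^+ 2 * delta * (2 * a ^+ 2)) =
        n ^+ 2 * delta * (2 * eps) by rewrite /eps; ring.
    have : a ^+ 2 <= (n * delta) ^+ 2 by rewrite ler_sqr // nnegrE ltW // mulr_gt0.
    have -> : (n * delta) ^+ 2 = n ^+ 2 * delta * delta by ring.
    rewrite mulr1 => /le_trans; apply.
    rewrite ler_pM2l; last exact: mulr_gt0.
    by rewrite /delta mulrC ler_pM2r //; lra.
  rewrite ler_pM2l ?exprn_gt0 //; lra.
have : 1 <= beta * (delta * (1 + 2 * a ^+ 2)).
  rewrite -(ler_pM2l n2) mulr1 mulrCA; apply: le_trans ratio _.
  by rewrite ler_pM2l.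
have X0 : 0 < (1 + 8 * a) * (1 + 2 * a ^+ 2) by nra.
(* The product expands to [1 - a - 70 * a ^+ 2 - 2 * a ^+ 3 - 144 * a ^+ 4]; the 9 is chosen to beat
   the 8 in [delta]. *)
have X1 : (1 - 9 * a) * ((1 + 8 * a) * (1 + 2 * a ^+ 2)) <= 1.
  have : 0 <= a ^+ 2 by exact: sqr_ge0.
  have : 0 <= a ^+ 3 by rewrite exprn_ge0 // ltW.
  nra.
move=> le1; rewrite div1r ler_pdivrMr // -(ler_pM2r X0).
apply: le_trans X1 _; apply: le_trans le1 _.
by rewrite /delta -!mulrA.
Qed.

Lemma grid_slt_bound (R : realType) (a : R) : 0 < a <= 1 / 8 ->
  exists (P : {fset 'rV[R]_3}) (s : P), forall (beta : R) (T : rel P),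
    is_slt (@point_weight R 3 P) (1 + a ^+ 4) beta s T ->
    (1 - 9 * a) * (1 / a ^+ 4) <= beta.
Proof.
move=> ha; have /andP[a0 a8] := ha.
pose delta := a ^+ 4 * (1 + 8 * a).
have eps0 : 0 < a ^+ 4 by rewrite exprn_gt0.
have delta0 : 0 < delta by rewrite mulr_gt0 //; lra.
(* The largest [k] whose grid has side at most [a], as the distance estimates require; maximality
   makes [k.+1] points per side enough for [ratio_bound]. *)
pose k := Num.truncn (a / delta).
have /andP[k_le k_lt] : k%:R <= a / delta < k.+1%:R.
  by apply: truncn_itv; rewrite divr_ge0 // ltW.
have {}k_le : delta * k%:R <= a by rewrite mulrC -ler_pdivlMr.
have {}k_lt : a <= k.+1%:R * delta by rewrite -ler_pdivrMr // ltW.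
have a2 : 0 <= a <= 1 / 2 by apply/andP; split; lra.
have [P [h [h_bij hE]]] := fset_of_injective (@grid_pos_inj R k _ delta0).
have [h' hK h'K] := h_bij; have h_inj := can_inj hK.
exists P, (h None) => beta T [_ beta1 [[symT irrT] _ _] distT lightT].
pose w := @point_weight R 3 P.
have wE u v : w (h u) (h v) = euclid_dist (grid_pos delta u) (grid_pos delta v).
  by rewrite /w /point_weight !hE.
have w0 u v : 0 <= w u v by exact: euclid_dist_ge0.
have wC u v : w u v = w v u by exact: euclid_distC.
have wxx u : w u u = 0 by exact: euclid_distxx.
have tri u v x : w u x <= w u v + w v x by exact: euclid_dist_triangle.
have card_nonroot :
    #|[pred v : option ('I_k.+1 * 'I_k.+1) | v != None]| = (k.+1 ^ 2)%N.
  rewrite (eq_card (_ : _ =i predC1 None)) // cardC1 card_option card_prod card_ord.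
  by rewrite expnS expn1.
have reindexP (F : P -> R) :
    \sum_(v | v != h None) F v = \sum_(v | v != None) F (h v).
  rewrite (reindex h) /=; last exact: onW_bij.
  by apply: eq_bigl => v; rewrite inj_eq.
have star t : t != h None -> T (h None) t.
  (* The gap is the detour cost minus the largest stretch allowance, since distances to the root are
     at most [1 + a]. The 8 in [delta] leaves [a * (5 - 16 * a)] times [a ^+ 4], positive for
     [a <= 1 / 8]. *)
  move=> ts; pose g := delta * (1 - 2 * a) - a ^+ 4 * (1 + a).
  apply: (edge_of_detour (w := w) (g := g) wxx tri irrT ts _ _ (distT t)).
    have -> : g = a ^+ 4 * (a * (5 - 16 * a)) by rewrite /g /delta; ring.
    by rewrite !mulr_gt0 //; lra.
  move=> u us ut; rewrite -/w -(h'K u) -(h'K t) !wE.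
  have nN x : x != h None -> h' x != None.
    by apply: contraNneq => <-; rewrite h'K.
  have h'ut : h' u != h' t by rewrite (inj_eq (can_inj h'K)).
  have d := grid_detour delta0 a2 k_le (nN u us) (nN t ts) h'ut.
  have le := grid_dist_root_le delta0 a2 k_le (nN t ts).
  have := ler_wpM2l (ltW eps0) le; rewrite /g; lra.
have T_ge : (k.+1 ^ 2)%:R <= graph_weight w T.
  apply: le_trans (graph_weight_star_ge w0 wC symT star).
  rewrite reindexP -card_nonroot -[leLHS]sumr_const.
  by apply: ler_sum => v nr; rewrite wE grid_dist_root_ge1.
(* The comb is transported to [P] along the bijection [h]. *)
pose par x := h (grid_parent (h' x)).
have par_rank x : x != h None -> (grid_rank (h' (par x)) < grid_rank (h' x))%N.
  move=> xs; rewrite hK grid_parent_rank //.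
  by apply: contraNneq xs => <-; rewrite h'K.
have treeP := spanning_tree_parent_rel par_rank.
have [m mst_m] := exists_mst w treeP.
have m_le : graph_weight w m <= (k.+1 ^ 2)%:R * delta + 1.
  apply: le_trans (mst_m.2 _ treeP) _.
  apply: le_trans (graph_weight_parent_rel_le _ _ w0 wC) _.
  rewrite reindexP.
  apply: (@le_trans _ _ (\sum_(v : option ('I_k.+1 * 'I_k.+1) | v != None)
      (delta + (v == Some (ord0, ord0))%:R))).
    by apply: ler_sum => v nr; rewrite /par hK wE grid_dist_parent.
  rewrite big_split /= sumr_const card_nonroot mulr_natl lerD2l.
  rewrite (bigD1 (Some (ord0, ord0))) //= big1 ?addr0 // => v /andP[_].
  by move/negbTE => ->.
apply: (ratio_bound (n := k.+1%:R)) => //.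
rewrite -natrX; apply: le_trans T_ge _; apply: le_trans (lightT m mst_m) _.
by rewrite ler_pM2l // (lt_le_trans _ beta1).
Qed.

Unset Implicit Arguments.

Theorem theorem1p3 (R : realType) :
  exists (eps0 : R) (eta : R -> R),
    [/\ 0 < eps0,
        forall eps : R, 0 < eps <= eps0 -> 0 <= eta eps,
        eta eps @[eps --> (0 : R)^'+] --> (0 : R) &
        forall eps : R, 0 < eps <= eps0 ->
          exists (P : {fset 'rV[R]_3}) (s : P),
            forall (beta : R) (T : rel P),
              is_slt (@point_weight R 3 P) (1 + eps) beta s T ->
              (1 - eta eps) * (1 / eps) <= beta].
Proof.
pose root4 (eps : R) := Num.sqrt (Num.sqrt eps).
have root4K eps : 0 <= eps -> root4 eps ^+ 4 = eps.
  by move=> e0; rewrite (exprM _ 2 2) !sqr_sqrtr ?sqrtr_ge0.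
(* With [a] the fourth root of [eps], the condition [a <= 1 / 8] dictates the threshold, and
   [1 - 9 * a] dictates [eta]. *)
exists ((1 / 8) ^+ 4), (fun eps => 9 * root4 eps); split.
- by rewrite exprn_gt0.
- by move=> eps _; rewrite mulr_ge0 ?sqrtr_ge0.
(* [Num.sqrt] vanishes on negative reals, so it is continuous at 0 from both sides and the right
   limit is a restriction. *)
- have cont : {for 0, continuous (fun eps => 9 * root4 eps)}.
    apply: continuousM; first exact: cst_continuous.
    by apply: continuous_comp; exact: sqrt_continuous.
  apply: cvg_at_right_filter; move: cont; rewrite /prop_for /continuous_at.
  by rewrite /root4 !sqrtr0 mulr0.
(* Only the [eps] in the stretch and in [1 / eps] become fourth powers; the one inside [eta] stays
   under the root. *)
- move=> eps /andP[e0 e_le]; have /root4K {1 3}<- := ltW e0.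
  apply: grid_slt_bound; rewrite !sqrtr_gt0 e0 /=.
  rewrite -(ler_pXn2r (isT : (0 < 4)%N)) ?nnegrE ?sqrtr_ge0 ?divr_ge0 //.
  by rewrite root4K // ltW.
Qed.
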